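(* Let $L$ be a finite trim lattice. Then every interval $[y,z]=\{w\in L: y\le w\le z\}$ of $L$ (with $y\le z$), regarded as a lattice, is trim.
   Context: All lattices are finite. An element $x$ of a lattice $L$ is left modular if for all $y<z$ in $L$, $(y\vee x)\wedge z=y\vee(x\wedge z)$. A join-irreducible is an element that is not the minimum $\hat0$ and cannot be written as the join of two strictly smaller elements; a meet-irreducible is an element that is not the maximum $\hat1$ and cannot be written as the meet of two strictly larger elements. A lattice $L$ is trim if, for some $n$, it has a maximal chain $\hat0=x_0\lessdot x_1\lessdot\cdots\lessdot x_n=\hat1$ consisting of $n+1$ left modular elements, and $L$ has exactly $n$ join-irreducibles and exactly $n$ meet-irreducibles. *)

(* Defs.v *)
From HB Require Import structures.
From mathcomp Require Import all_boot all_order.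

Set Implicit Arguments.
Unset Strict Implicit.
Unset Printing Implicit Defensive.

Import Order.TTheory.
Local Open Scope order_scope.

Section Trim.

Context {d : Order.disp_t} (L : finTBLatticeType d).
Implicit Types x y z a b : L.

Definition covered_by x y : bool :=
  (x < y) && ~~ [exists a, x < a < y].

Definition left_modular x : Prop :=
  forall y z, y < z -> (y `|` x) `&` z = y `|` (x `&` z).

Definition join_irreducible x : bool :=
  (x != \bot) && ~~ [exists a, exists b, [&& a < x, b < x & x == a `|` b]].

Definition meet_irreducible x : bool :=
  (x != \top) && ~~ [exists a, exists b, [&& x < a, x < b & x == a `&` b]].

(* Only the values x 0, ..., x n matter. *)
Definition maximal_chain (n : nat) (x : nat -> L) : Prop :=
  [/\ x 0%N = \bot, x n = \top
    & forall i : nat, (i < n)%N -> covered_by (x i) (x i.+1)].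

Definition trim : Prop :=
  exists (n : nat) (x : nat -> L),
    [/\ maximal_chain n x,
        forall i : nat, (i <= n)%N -> left_modular (x i),
        #|[set a | join_irreducible a]| = n
      & #|[set a | meet_irreducible a]| = n].

End Trim.

(* The proof of y <= z is a parameter because the interval is a bounded
   lattice only when it is nonempty. *)
Section Interval.

Context {d : Order.disp_t} (L : finTBLatticeType d) (y z : L).

Definition in_interval : pred L := fun w => y <= w <= z.

Record interval (hyz : y <= z) : Type :=
  Interval { interval_val : L; interval_valP : in_interval interval_val }.

Variable hyz : y <= z.

HB.instance Definition _ := [isSub for @interval_val hyz].
HB.instance Definition _ := [Finite of interval hyz by <:].
HB.instance Definition _ :=
  [SubChoice_isSubPOrder of interval hyz by <: with d].

Fact in_interval_meet : meet_closed in_interval.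
Proof.
move=> u v /andP[yu uz] /andP[yv vz].
by apply/andP; rewrite lexI yu yv leIxl.
Qed.

Fact in_interval_join : join_closed in_interval.
Proof.
move=> u v /andP[yu uz] /andP[yv vz].
by apply/andP; rewrite leUx uz vz lexUl.
Qed.

HB.instance Definition _ :=
  Order.SubPOrder_isSubLattice.Build d L in_interval d (interval hyz)
    in_interval_meet in_interval_join.

Fact in_interval_bot : in_interval y.
Proof. by rewrite /in_interval lexx. Qed.

Fact in_interval_top : in_interval z.
Proof. by rewrite /in_interval lexx andbT. Qed.

Definition interval_bot : interval hyz := Interval hyz in_interval_bot.
Definition interval_top : interval hyz := Interval hyz in_interval_top.

Fact interval_le0x (w : interval hyz) : interval_bot <= w.
Proof. by rewrite -Order.le_val; have /andP[] := valP w. Qed.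

Fact interval_lex1 (w : interval hyz) : w <= interval_top.
Proof. by rewrite -Order.le_val; have /andP[] := valP w. Qed.

HB.instance Definition _ :=
  Order.hasBottom.Build d (interval hyz) interval_le0x.
HB.instance Definition _ :=
  Order.hasTop.Build d (interval hyz) interval_lex1.

End Interval.

(* Main.v *)
(* Let x be the left modular chain of length n.  As there are exactly n
   join-irreducibles, some join-irreducible j_i is the least element below
   x_(i+1) and not below x_i; dually, some meet-irreducible m_i is the greatest
   element above x_i and not above x_(i+1).  Left modularity labels each cover
   a < b with the step i at which a v x_i jumps above b, and this label satisfies
   j_i <= b, j_i !<= a, a <= m_i, b !<= m_i.  In [y, z], the elements
   (y v x_i) ^ z are left modular and form, after removal of repetitions, a
   maximal chain, since a label occurs at most once on any chain; its steps are
   exactly the labels of covers in [y, z].  A join-irreducible of [y, z] whose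
   lower cover has label i must be y v j_i, so there are at most as many as there
   are labels, and at least that many because of the chain. *)

Require Import Defs.
From HB Require Import structures.
From mathcomp Require Import all_boot all_order.

Set Implicit Arguments.
Unset Strict Implicit.
Unset Printing Implicit Defensive.

Import Order.TTheory.
Local Open Scope order_scope.

(** * Minimal elements in a finite lattice *)

Section Minimal.

Context {d : Order.disp_t} {L : finTBLatticeType d}.
Implicit Types a b c w v : L.

(** Among the elements of [P] below [w], one with the smallest down-set is minimal, since going
    strictly down shrinks the down-set strictly. *)
Lemma exists_minimal (P : pred L) w :
  P w -> exists a, [/\ a <= w, P a & forall b, b < a -> ~~ P b].
Proof.
move=> Pw; pose Q a := (a <= w) && P a.
have Qw : Q w by rewrite /Q lexx.
have [a /andP[aw Pa] amin] := arg_minnP (fun a => #|[set b | b <= a]|) Qw.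
exists a; split=> // b ltba; apply/negP => Pb.
have /amin : Q b by rewrite /Q Pb (le_trans (ltW ltba) aw).
apply/negP; rewrite -ltnNge; apply: proper_card.
apply/properP; split; last by exists a; rewrite !inE ?lexx // lt_geF.
by apply/subsetP => c; rewrite !inE => /le_trans; apply; apply: ltW.
Qed.

End Minimal.

(** * Covers, join-irreducibles and chains *)

Section LatticeTheory.

Context {d : Order.disp_t} {L : finTBLatticeType d}.
Implicit Types a b c w v : L.

Lemma exists_maximal (P : pred L) w :
  P w -> exists a, [/\ w <= a, P a & forall b, a < b -> ~~ P b].
Proof. exact: (@exists_minimal _ L^d). Qed.

Lemma covered_by_meet a b c : covered_by a b -> a <= c -> ~~ (b <= c) ->
  c `&` b = a.
Proof.
case/andP=> ltab /existsPn noab leac nbc; apply/eqP; rewrite eq_sym.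
have le_a : a <= c `&` b by rewrite lexI leac ltW.
apply: contraR (noab (c `&` b)) => neq; rewrite lt_neqAle neq le_a /=.
by rewrite lt_neqAle leIr andbT; apply: contra nbc => /eqP <-; exact: leIl.
Qed.

Lemma left_modularE a b c : left_modular a -> b <= c ->
  (b `|` a) `&` c = b `|` (a `&` c).
Proof.
move=> lm; rewrite le_eqVlt => /predU1P[->|/lm//].
by rewrite joinIKC joinC meetUK.
Qed.

(** A minimal element among those not below [v] works: were it the join of two smaller elements,
    both would lie below [v], and so would it. *)
Lemma exists_join_irreducible w v : ~~ (w <= v) ->
  exists a, [/\ join_irreducible a, a <= w & ~~ (a <= v)].
Proof.
move=> /(@exists_minimal _ L (fun a => ~~ (a <= v)))[a [aw av amin]].
exists a; split=> //; apply/andP; split.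
  by apply: contraNneq av => ->; exact: le0x.
apply/existsPn => b; apply/existsPn => c; apply/and3P => -[/amin + /amin + /eqP].
rewrite !negbK => bv cv aE; by move: av; rewrite aE leUx bv cv.
Qed.


(** Take [c] maximal strictly below [a]. If [b < a], the join of [c] and [b] is not [a] by
    irreducibility, so it is [c] by maximality, and [b <= c]. *)
Lemma join_irreducible_cover a : join_irreducible a ->
  exists2 c, covered_by c a & forall b, b <= a -> ~~ (b <= c) -> b = a.
Proof.
case/andP=> a0 /existsPn irr.
have P0 : \bot < a by rewrite lt_neqAle eq_sym a0 le0x.
have [c [_ ltca cmax]] := @exists_maximal (fun c => c < a) _ P0.
exists c; first by rewrite /covered_by ltca; apply/existsPn => b;
  apply/negP => /andP[/cmax/negP cb /cb].
move=> b leba nbc; apply/eqP; apply: contraNT nbc => neba.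
have ltba : b < a by rewrite lt_neqAle neba.
have leca : c `|` b <= a by rewrite leUx leba ltW.
have /existsPn/(_ b) := irr c; rewrite ltca ltba /= => neq.
have ltU : c `|` b < a by rewrite lt_neqAle eq_sym neq.
suff <- : c `|` b = c by exact: leUr.
apply/eqP; apply: contraTT ltU => neU; apply: cmax.
by rewrite lt_neqAle eq_sym neU leUl.
Qed.

(** Applied to the lower cover [c] of a join-irreducible [a], the hypothesis gives [e i] below [a]
    but not below [c], hence equal to [a]. *)
Lemma card_join_irreducible_le (I : finType) (S : {set I}) (e : I -> L) :
    (forall a b, covered_by a b ->
       exists i, [/\ i \in S, e i <= b & ~~ (e i <= a)]) ->
  (#|[set a : L | join_irreducible a]| <= #|S|)%N.
Proof.
move=> covE; apply: leq_trans (leq_imset_card e S); apply: subset_leq_card.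
apply/subsetP => a; rewrite inE => /join_irreducible_cover[c /covE[i [iS ea ec]]].
by move=> /(_ _ ea ec) <-; exact: imset_f.
Qed.

(** * Join-irreducibles attached to the steps of a chain *)

Section Chain.

Variables (n : nat) (x : nat -> L).
Hypothesis x_lt : forall i, (i < n)%N -> x i < x i.+1.

Lemma chain_le i k : (i <= k)%N -> (k <= n)%N -> x i <= x k.
Proof.
elim: k => [|k IHk]; first by rewrite leqn0 => /eqP->.
rewrite leq_eqVlt => /predU1P[->//|ik] kn.
by rewrite (le_trans (IHk ik (ltnW kn))) // ltW ?x_lt.
Qed.

Lemma chain_join_irreducible : exists2 j : 'I_n -> L, injective j &
  forall i, [/\ join_irreducible (j i), j i <= x i.+1 & ~~ (j i <= x i)].
Proof.
have ex_j (i : 'I_n) : exists a,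
    [/\ join_irreducible a, a <= x i.+1 & ~~ (a <= x i)].
  by apply: exists_join_irreducible; rewrite lt_geF ?x_lt.
have [j jP] := fin_all_exists ex_j; exists j => //.
have jlt (i k : 'I_n) : (i < k)%N -> j i != j k.
  move=> ik; have [[_ ji _] [_ _]] := (jP i, jP k); apply: contraNneq => <-.
  by rewrite (le_trans ji) // chain_le // ltnW.
move=> i k jik; apply/val_inj; case: (ltngtP i k) => // /jlt.
  by rewrite jik eqxx.
by rewrite jik eqxx.
Qed.

Lemma leq_card_join_irreducible :
  (n <= #|[set a : L | join_irreducible a]|)%N.
Proof.
have [j j_inj jP] := chain_join_irreducible.
rewrite -[leqLHS]card_ord -(card_imset _ j_inj); apply: subset_leq_card.
by apply/subsetP => _ /imsetP[i _ ->]; rewrite inE; case: (jP i).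
Qed.

(** By counting, the chosen [j] exhaust the join-irreducibles. One that is below [w] and not below
    [x i] is thus some [j k], and its position relative to the chain forces [k = i]. *)
Lemma extremal_join : #|[set a : L | join_irreducible a]| = n ->
  exists j : 'I_n -> L, forall i : 'I_n,
    [/\ j i <= x i.+1, ~~ (j i <= x i)
      & forall w, w <= x i.+1 -> ~~ (w <= x i) -> j i <= w].
Proof.
move=> cardJ; have [j j_inj jP] := chain_join_irreducible.
exists j => i; have [_ ji nji] := jP i; split=> // w wi nwi.
have [a [Ja aw nai]] : exists a,
    [/\ join_irreducible a, a <= w & ~~ (a <= x i)].
  exact: exists_join_irreducible.
have /imsetP[k _ aE] : a \in j @: setT.
  suff -> : j @: setT = [set a : L | join_irreducible a] by rewrite inE.
  apply/eqP; rewrite eqEcard cardJ card_imset // cardsT card_ord leqnn andbT.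
  by apply/subsetP => _ /imsetP[k _ ->]; rewrite inE; case: (jP k).
have [_ jk njk] := jP k; rewrite -aE in jk njk.
suff -> : i = k by rewrite -aE.
apply/val_inj; case: (ltngtP i k) => // [ik|ki].
  case/negP: njk; apply: le_trans (chain_le ik (ltnW (ltn_ord k))).
  exact: le_trans wi.
by case/negP: nai; apply: le_trans (chain_le ki (ltnW (ltn_ord i))).
Qed.

End Chain.

Lemma refine_weak_chain n (u : nat -> L) :
    (forall i, (i < n)%N -> u i != u i.+1 -> covered_by (u i) (u i.+1)) ->
  exists v : nat -> L, let k := #|[set i : 'I_n | u i != u i.+1]| in
    [/\ v 0%N = u 0%N, v k = u n,
        forall i, (i < k)%N -> covered_by (v i) (v i.+1)
      & forall i, (i <= k)%N -> exists2 l, (l <= n)%N & v i = u l].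
Proof.
(* Written as a sum, the number of proper steps splits off its last term in the induction. *)
have cardE m : #|[set i : 'I_m | u i != u i.+1]| =
    \sum_(i < m) (u i != u i.+1).
  by rewrite -sum1dep_card big_mkcond; apply: eq_bigr => i _; case: (_ != _).
elim: n => [|n IHn] u_cov.
  exists u; rewrite /= cardE big_ord0; split=> // i.
  by rewrite leqn0 => /eqP->; exists 0%N.
have [|v] := IHn; first by move=> i /ltnW; exact: u_cov.
rewrite /= !cardE big_ord_recr /=; set k := (\sum_(i < n) _)%N.
move=> [v0 vk v_cov vu].
have [eu|neu] /= := eqVneq (u n) (u n.+1).
  exists v; rewrite addn0; split=> //; first by rewrite vk.
  by move=> i /vu[l ln ->]; exists l => //; exact: leqW.
exists (fun i => if (i <= k)%N then v i else u n.+1).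
rewrite addn1 ltnn; split=> // i.
  rewrite ltnS => ik; rewrite ik; case: (ltnP i k) => [/v_cov//|ki].
  have -> : i = k by apply/eqP; rewrite eqn_leq ik ki.
  by rewrite vk; exact: u_cov.
case: (leqP i k) => [/vu[l ln ->] _|_ _]; last by exists n.+1.
by exists l => //; exact: leqW.
Qed.

End LatticeTheory.

(** * Meet-irreducibles, by order duality *)

Section Dual.

Context {d : Order.disp_t} {L : finTBLatticeType d}.
Implicit Types a b c w v : L.

Lemma covered_by_dual a b : covered_by a b = @covered_by _ L^d b a.
Proof.
rewrite /covered_by; congr (_ && ~~ _).
by apply: eq_existsb => c; rewrite andbC.
Qed.

Lemma card_meet_irreducible_le (I : finType) (S : {set I}) (e : I -> L) :
    (forall a b, covered_by a b ->
       exists i, [/\ i \in S, a <= e i & ~~ (b <= e i)]) ->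
  (#|[set a : L | meet_irreducible a]| <= #|S|)%N.
Proof.
move=> covE; apply: (@card_join_irreducible_le _ L^d I S e) => a b.
by rewrite -covered_by_dual; exact: covE.
Qed.

Section Chain.

Variables (n : nat) (x : nat -> L).
Hypothesis x_lt : forall i, (i < n)%N -> x i < x i.+1.

Let dual_lt i : (i < n)%N -> ((x (n - i) : L^d) < x (n - i.+1)).
Proof.
move=> ltin; change (x (n - i.+1) < x (n - i)).
by rewrite -(subnSK ltin) x_lt // subnSK // leq_subr.
Qed.

Lemma leq_card_meet_irreducible :
  (n <= #|[set a : L | meet_irreducible a]|)%N.
Proof. exact: (leq_card_join_irreducible dual_lt). Qed.

Lemma extremal_meet : #|[set a : L | meet_irreducible a]| = n ->
  exists m : 'I_n -> L, forall i : 'I_n,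
    [/\ x i <= m i, ~~ (x i.+1 <= m i)
      & forall w, x i <= w -> ~~ (x i.+1 <= w) -> w <= m i].
Proof.
(* Duality reverses the chain, so step [i] becomes step [n - i.+1]. *)
move=> /(extremal_join dual_lt)[m mP]; exists (m \o @rev_ord n) => i.
have := mP (rev_ord i).
by rewrite /= subnSK // !subKn // ltnW.
Qed.

End Chain.

End Dual.

(** * The label of a pair [a < b] at a left modular step *)

Section LeftModularStep.

Context {d : Order.disp_t} {L : finTBLatticeType d} (p q : L).
Hypotheses (p_lm : left_modular p) (q_lm : left_modular q).

(** Either inequality would give [b <= a]: left modularity of [q], respectively [p], writes [b] as
    the join of [a] with its meet with that element, and this meet is below [a]. *)
Lemma left_modular_step a b : a < b -> b <= a `|` q -> p `&` b <= a ->
  ~~ (q `&` b <= p) /\ ~~ (q <= a `|` p).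
Proof.
move=> ltab b_q p_a; split; apply: contraL (ltab) => le_q; rewrite le_gtF //.
  rewrite -(meet_r b_q) (left_modularE q_lm (ltW ltab)) leUx lexx /=.
  by rewrite (le_trans _ p_a) // lexI le_q leIr.
have b_p : b <= a `|` p by rewrite (le_trans b_q) // leUx leUl.
by rewrite -(meet_r b_p) (left_modularE p_lm (ltW ltab)) leUx lexx.
Qed.

Variables j m : L.
Hypothesis cov_pq : covered_by p q.
Hypotheses (jq : j <= q) (njp : ~~ (j <= p)).
Hypothesis j_min : forall w, w <= q -> ~~ (w <= p) -> j <= w.
Hypotheses (pm : p <= m) (nqm : ~~ (q <= m)).
Hypothesis m_max : forall w, p <= w -> ~~ (q <= w) -> w <= m.

Lemma label_not_le w : p <= w -> ~~ (q <= w) -> ~~ (j <= w).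
Proof.
move=> pw nqw; apply: contra njp => jw.
by rewrite -(covered_by_meet cov_pq pw nqw) lexI jw.
Qed.

(** The extremal properties of [j] and [m] are applied to the meet of [q] and [b] and to the join of
    [a] and [p]. *)
Lemma left_modular_step_label a b :
    a < b -> b <= a `|` q -> p `&` b <= a ->
  [/\ j <= b, ~~ (j <= a), a <= m & ~~ (b <= m)].
Proof.
move=> ltab b_q p_a; have [nqb nqa] := left_modular_step ltab b_q p_a.
split.
- by apply: le_trans (j_min (leIl q b) nqb) _; exact: leIr.
- by apply: contra (label_not_le (leUr p a) nqa) => /le_trans; apply; exact: leUl.
- by apply: le_trans (leUl a p) (m_max (leUr p a) nqa).
- apply: contra nqb => bm; rewrite -(covered_by_meet cov_pq pm nqm) lexI.
  by rewrite leIl (le_trans (leIr _ _) bm).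
Qed.

End LeftModularStep.

(** * Projection to the interval *)

Section IntervalTrim.

Context {d : Order.disp_t} {L : finTBLatticeType d} {y z : L} (hyz : y <= z).
Implicit Types (a b c : interval hyz) (w : L).

Fact clamp_subproof w : in_interval y z ((y `|` w) `&` z).
Proof. by rewrite /in_interval leIr lexI leUl hyz. Qed.

(** A monotone retraction onto the interval; for left modular [w] the join with [y] and the meet
    with [z] may be taken in either order. *)
Definition clamp w : interval hyz := Interval hyz (clamp_subproof w).

Lemma val_clamp w : val (clamp w) = (y `|` w) `&` z.
Proof. by []. Qed.

Lemma interval_ge a : y <= val a.
Proof. by case/andP: (valP a). Qed.

Lemma interval_le a : val a <= z.
Proof. by case/andP: (valP a). Qed.

Lemma val_meet a b : val (a `&` b) = val a `&` val b.
Proof. by []. Qed.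

Lemma val_join a b : val (a `|` b) = val a `|` val b.
Proof. by []. Qed.

Lemma clamp0 : clamp \bot = \bot.
Proof. by apply/val_inj; rewrite val_clamp joinx0 meet_l. Qed.

Lemma clamp1 : clamp \top = \top.
Proof. by apply/val_inj; rewrite val_clamp joinx1 meet1x. Qed.

Lemma le_clamp w w' : w <= w' -> clamp w <= clamp w'.
Proof. by move=> le_w; rewrite -Order.le_val !val_clamp leI2 ?leU2. Qed.

(** Left modularity of [w] turns both sides into the join of [a] with the meet of [w] and [b]. *)
Lemma left_modular_clamp w : left_modular w -> left_modular (clamp w).
Proof.
move=> lm a b ltab; apply/val_inj.
rewrite val_meet !val_join val_meet !val_clamp.
have leab : val a <= val b by rewrite Order.le_val ltW.
rewrite (left_modularE lm hyz) joinA (join_l (interval_ge a)).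
rewrite -(left_modularE lm (interval_le a)) -meetA.
rewrite (meet_r (interval_le b)) (left_modularE lm leab).
rewrite -(left_modularE lm hyz) -meetA (meet_r (interval_le b)).
by rewrite (left_modularE lm (interval_ge b)) joinA (join_l (interval_ge a)).
Qed.

(** * Labels of the covers in the interval *)

Section Labels.

Variables (n : nat) (x : nat -> L) (j m : 'I_n -> L).
Hypotheses (x0 : x 0%N = \bot) (xn : x n = \top).
Hypothesis x_cov : forall i : nat, (i < n)%N -> covered_by (x i) (x i.+1).
Hypothesis x_lm : forall i : nat, (i <= n)%N -> left_modular (x i).
Hypothesis jP : forall i : 'I_n,
  [/\ j i <= x i.+1, ~~ (j i <= x i)
    & forall w, w <= x i.+1 -> ~~ (w <= x i) -> j i <= w].
Hypothesis mP : forall i : 'I_n,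
  [/\ x i <= m i, ~~ (x i.+1 <= m i)
    & forall w, x i <= w -> ~~ (x i.+1 <= w) -> w <= m i].

Lemma step_label (i : 'I_n) (a b : L) :
    a < b -> b <= a `|` x i.+1 -> x i `&` b <= a ->
  [/\ j i <= b, ~~ (j i <= a), a <= m i & ~~ (b <= m i)].
Proof.
have [ji nji jmin] := jP i; have [mi nmi mmax] := mP i.
apply: left_modular_step_label => //.
- by apply: x_lm; exact: ltnW.
- exact: x_lm.
- exact: x_cov.
Qed.

Lemma clamp_covered_by i : (i < n)%N -> clamp (x i) != clamp (x i.+1) ->
  covered_by (clamp (x i)) (clamp (x i.+1)).
Proof.
move=> ltin neq; have /andP[ltx _] := x_cov ltin.
rewrite /covered_by lt_neqAle neq le_clamp ?ltW //=.
(* Every pair [a < b] in this range has label [i]; an element [c] strictly between would be both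
   above and not above [j i]. *)
have lab a b : clamp (x i) <= a -> a < b -> b <= clamp (x i.+1) ->
    j (Ordinal ltin) <= val b /\ ~~ (j (Ordinal ltin) <= val a).
  rewrite -!Order.le_val -lt_val !val_clamp => ua ltab bu.
  have [] // := @step_label (Ordinal ltin) _ _ ltab.
    by rewrite (le_trans bu) // leIxl // leU2 ?interval_ge.
  rewrite (le_trans _ ua) // lexI (le_trans (leIr _ _) (interval_le b)) andbT.
  by rewrite leIxl // leUr.
apply/existsPn => c; apply/negP => /andP[ltc ltc'].
have [jc _] := lab _ _ (lexx _) ltc (ltW ltc').
by have [_] := lab _ _ (ltW ltc) ltc' (lexx _); rewrite jc.
Qed.

Lemma exists_label a b : covered_by a b -> exists i : 'I_n,
  val b <= val a `|` x i.+1 /\ x i `&` val b <= val a.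
Proof.
move=> cov_ab; have /andP[ltab _] := cov_ab.
have ex_i : exists i, val b <= val a `|` x i.
  by exists n; rewrite xn joinx1 lex1.
case: (ex_minnP ex_i) => -[|i] b_i i_min.
  by move: b_i; rewrite x0 joinx0 lt_geF ?lt_val.
have ltin : (i < n)%N by apply: i_min; rewrite xn joinx1 lex1.
exists (Ordinal ltin); split=> //=.
(* The cover lives in the interval, so [x i] is clamped before the cover property is used. *)
have nb_i : ~~ (b <= a `|` clamp (x i)).
  apply/negP; rewrite -Order.le_val val_join val_clamp => le_b.
  suff /i_min : val b <= val a `|` x i by rewrite ltnn.
  rewrite (le_trans le_b) // leUx leUl leIxl // leU2 //; exact: interval_ge.
rewrite -[X in _ <= val X](covered_by_meet cov_ab (leUl _ _) nb_i).
rewrite val_meet val_join val_clamp lexI leIr andbT.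
by rewrite lexUr // lexI leIxl ?leUr //= leIxr ?interval_le.
Qed.

Lemma covered_by_label a b : covered_by a b -> exists i : 'I_n,
  [/\ i \in [set i : 'I_n | clamp (x i) != clamp (x i.+1)],
      clamp (j i) <= b, ~~ (clamp (j i) <= a),
      a <= clamp (m i) & ~~ (b <= clamp (m i))].
Proof.
move=> cov_ab; have /andP[ltab _] := cov_ab.
have [i [b_i i_a]] := exists_label cov_ab; exists i.
rewrite -lt_val in ltab; have [jb nja am nbm] := step_label ltab b_i i_a.
have [ji nji _] := jP i; have [mi nmi _] := mP i.
have jz : j i <= z := le_trans jb (interval_le b).
have ym : y <= m i := le_trans (interval_ge a) am.
have njm : ~~ (j i <= m i) by apply: (label_not_le (x_cov (ltn_ord i))).
rewrite inE -!Order.le_val !val_clamp; split.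
(* If the clamped chain stood still at step [i], then [j i] would be below the join of [y] and
   [x i], hence below [m i]. *)
- apply: contra njm => /eqP/(congr1 val); rewrite !val_clamp => eq_u.
  have : j i <= (y `|` x i.+1) `&` z by rewrite lexI jz lexUr.
  by rewrite -eq_u lexI => /andP[/le_trans + _]; apply; rewrite leUx ym.
- by rewrite leIxl // leUx interval_ge.
- by apply: contra nja; apply: le_trans; rewrite lexI jz leUr.
- by rewrite lexI lexUr // interval_le.
- by apply: contra nbm => /le_trans; apply; rewrite leIxl // leUx ym lexx.
Qed.

End Labels.

End IntervalTrim.

Theorem theorem1 (d : Order.disp_t) (L : finTBLatticeType d) :
  trim L -> forall (y z : L) (hyz : (y <= z)%O), trim (interval hyz).
Proof.
move=> [n [x [[x0 xn x_cov] x_lm cardJ cardM]]] y z hyz.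
have x_lt i : (i < n)%N -> x i < x i.+1 by case/x_cov/andP.
have [j jP] := extremal_join x_lt cardJ.
have [m mP] := extremal_meet x_lt cardM.
pose u i := clamp hyz (x i).
have u_cov i : (i < n)%N -> u i != u i.+1 -> covered_by (u i) (u i.+1).
  exact: (clamp_covered_by x_cov x_lm jP mP).
have labels := covered_by_label (hyz := hyz) x0 xn x_cov x_lm jP mP.
have [v [v0 vk v_cov vu]] := refine_weak_chain u_cov.
set k := #|_| in vk v_cov vu.
have v_lt i : (i < k)%N -> v i < v i.+1 by case/v_cov/andP.
exists k, v; split.
- by split=> //; rewrite ?v0 ?vk /u ?x0 ?xn ?clamp0 ?clamp1.
- by move=> i /vu[l ln ->]; apply: left_modular_clamp; exact: x_lm.
(* The chain [v] bounds the count from below by [k]; the [k] labels bound it from above. *)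
- apply/eqP; rewrite eqn_leq (leq_card_join_irreducible v_lt) andbT.
  apply: (card_join_irreducible_le (e := clamp hyz \o j)) => a b /labels.
  by case=> i [iS jb nja _ _]; exists i.
- apply/eqP; rewrite eqn_leq (leq_card_meet_irreducible v_lt) andbT.
  apply: (card_meet_irreducible_le (e := clamp hyz \o m)) => a b /labels.
  by case=> i [iS _ _ am nbm]; exists i.
Qed.
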